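(* Let $\Lambda$ be a commutative discrete valuation ring. Let $\alpha,\beta,\gamma$ be partitions and let $\Sigma$ be a socle tableau of shape $(\alpha,\beta,\gamma)$. Then there exists an embedding $(A\subset B)$ of $\Lambda$-modules whose socle tableau is $\Sigma$.
   Context: Let $p$ be a generator of the maximal ideal of $\Lambda$. All $\Lambda$-modules have finite length. For a partition $\lambda=(\lambda_1\ge\dots\ge\lambda_n\geq 1)$ put $N_\lambda=\Lambda/(p^{\lambda_1})\oplus\cdots\oplus\Lambda/(p^{\lambda_n})$; a $\Lambda$-module $M$ has (partition) type $\lambda$ if $M\cong N_\lambda$ (every finite length module has a unique type). An embedding $(A\subset B)$ consists of a $\Lambda$-module $B$ and a submodule $A$ of $B$. For a module $A$, $\mathrm{soc}^\ell A=\{a\in A: p^\ell a=0\}$. The Young diagram of a partition $\lambda$ is drawn with columns of lengths $\lambda_1,\lambda_2,\dots$ from left to right, aligned at the top; rows are numbered from top to bottom, columns from left to right. $\lambda'$ denotes the transpose, so $\lambda'_i=\#\{j:\lambda_j\ge i\}$ is the length of the $i$-th row. If $\gamma\le\beta$ (i.e. $\gamma_i\le\beta_i$ for all $i$), the skew diagram $\beta\setminus\gamma$ consists of the boxes in row $r$ and column $j$ with $\gamma_j<r\le\beta_j$. A socle tableau of shape $(\alpha,\beta,\gamma)$ (which requires $\gamma\le\beta$ and $|\alpha|+|\gamma|=|\beta|$) is a filling of $\beta\setminus\gamma$ with $\alpha'_1$ entries $1$, $\alpha'_2$ entries $2$, etc., such that: (ST-1) in each row, the entries are weakly decreasing (from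 left to right); (ST-2) in each column, the entries are strictly decreasing (from top to bottom); (ST-3) for each vertical line, and each natural number $\ell\ge1$, there are at most as many entries $\ell+1$ on the left hand side of the line as there are entries $\ell$. Equivalently the tableau is given by the decreasing sequence of partitions $(\sigma^{(0)},\dots,\sigma^{(s)})$, $s=\alpha_1$, where the Young diagram of $\sigma^{(i)}$ consists of all empty boxes (those of $\gamma$) and the boxes with entries $>i$; so $\sigma^{(0)}=\beta$, $\sigma^{(s)}=\gamma$, and the entries $\ell$ fill $\sigma^{(\ell-1)}\setminus\sigma^{(\ell)}$. The socle tableau of an embedding $(A\subset B)$, where $A$, $B$, $B/A$ have types $\alpha,\beta,\gamma$, is the tableau given by the sequence $(\sigma^{(i)})_{0\le i\le s}$, $s=\alpha_1$, where $\sigma^{(i)}$ is the type of $B/\mathrm{soc}^iA$. *)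

(* Defs.v *)
From HB Require Import structures.
From mathcomp Require Import all_boot all_algebra.
From mathcomp Require Import generic_quotient ring_quotient boolp.

Set Implicit Arguments.
Unset Strict Implicit.
Unset Printing Implicit Defensive.

Import GRing.Theory.
Local Open Scope ring_scope.
Local Open Scope quotient_scope.

Section Modules.
Variables (R : comNzRingType) (B : lmodType R).

Section Submodule.
Variable A : submodClosed B.

Record submod_type := SubmodElt { submod_val :> B; _ : submod_val \in A }.

HB.instance Definition _ := [isSub for submod_val].
HB.instance Definition _ := [Choice of submod_type by <:].
HB.instance Definition _ := [SubChoice_isSubLmodule of submod_type by <:].

End Submodule.

(* submodClosed, being stated for semimodules, does not provide the closure
   under opposites required by the quotient; this copy of A does. *)
Definition submod_pred (A : submodClosed B) : {pred B} := A.

HB.instance Definition _ (A : submodClosed B) :=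
  GRing.isSubmodClosed.Build R B (submod_pred A) (submodClosedP A).

(* The library's quotient of the Z-module B by A, equipped with the induced
   scaling; it is not a module in the library. *)
Definition modquot (A : submodClosed B) := {ideal_quot (submod_pred A)}.

HB.instance Definition _ A := GRing.Zmodule.on (modquot A).

Section Quotient.
Variable A : submodClosed B.
Local Notation Q := {ideal_quot (submod_pred A)}.

Definition modquot_scale (c : R) (x : modquot A) : modquot A :=
  \pi_Q (c *: repr (x : Q)).

Lemma modquot_scale_pi c (x : B) :
  modquot_scale c (\pi_Q x) = \pi_Q (c *: x).
Proof.
apply/eqP; rewrite -Quotient.idealrBE -scalerBr rpredZ //.
by rewrite Quotient.idealrBE reprK.
Qed.

Fact modquot_scaleA a b x :
  modquot_scale a (modquot_scale b x) = modquot_scale (a * b) x.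
Proof.
by rewrite -[x](@reprK _ Q) !modquot_scale_pi scalerA.
Qed.

Fact modquot_scale1 : left_id 1 modquot_scale.
Proof.
by move=> x; rewrite -[x](@reprK _ Q) modquot_scale_pi scale1r.
Qed.

Fact modquot_scaleDr : right_distributive modquot_scale +%R.
Proof.
move=> c x y; rewrite -[x](@reprK _ Q) -[y](@reprK _ Q).
rewrite !modquot_scale_pi.
have piD (u v : B) : (\pi_Q u : modquot A) + \pi_Q v
    = \pi_Q (u + v) by rewrite [RHS]pi_addr.
by rewrite !piD modquot_scale_pi scalerDr.
Qed.

Fact modquot_scaleDl x : {morph modquot_scale^~ x : a b / a + b}.
Proof.
move=> a b; rewrite -[x](@reprK _ Q) !modquot_scale_pi.
by rewrite scalerDl [LHS]pi_addr.
Qed.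

HB.instance Definition _ := GRing.Zmodule_isLmodule.Build R (modquot A)
  modquot_scaleA modquot_scale1 modquot_scaleDr modquot_scaleDl.

End Quotient.

Section Socle.
Variables (p : R) (l : nat) (A : submodClosed B).

Definition soc : {pred B} := [pred a | (a \in A) && (p ^+ l *: a == 0)].

Fact soc_submod_closed : submod_closed soc.
Proof.
split=> [|c x y]; rewrite !inE ?rpred0 ?scaler0 ?eqxx //.
move=> /andP[Ax /eqP px] /andP[Ay /eqP py].
by rewrite rpredD ?rpredZ // scalerDr py scalerA mulrC -scalerA px
  scaler0 addr0 eqxx.
Qed.

HB.instance Definition _ := GRing.isSubmodClosed.Build R B soc
  soc_submod_closed.

End Socle.
End Modules.

Section Ideals.
Variable R : comNzRingType.

(* Ideals of R are submodules of the regular module R^o. *)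
Definition principal (c : R) : {pred R^o} :=
  [pred x : R^o | `[< exists y : R, x = y * c >]].

Fact principal_submod_closed (c : R) : submod_closed (principal c).
Proof.
split=> [|a x y]; first by apply/asboolP; exists 0; rewrite mul0r.
move=> /asboolP[u ->] /asboolP[v ->]; apply/asboolP; exists (a * u + v).
by rewrite mulrDl -mulrA.
Qed.

HB.instance Definition _ (c : R) := GRing.isSubmodClosed.Build R R^o
  (principal c) (principal_submod_closed c).

Definition is_maximal_ideal (I : submodClosed R^o) : Prop :=
  ~ (I =i predT) /\
  forall J : submodClosed R^o, {subset I <= J} -> J =i I \/ J =i predT.

Definition is_local : Prop :=
  exists2 I : submodClosed R^o, is_maximal_ideal I &
    forall J : submodClosed R^o, is_maximal_ideal J -> J =i I.

Definition is_principal_ring : Prop :=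
  forall I : submodClosed R^o, exists c : R, I =i principal c.

End Ideals.

(* A local principal ideal domain that is not a field. *)
Definition is_dvr (R : idomainType) : Prop :=
  [/\ is_principal_ring R, is_local R &
      ~ (forall x : R, x != 0 -> x \is a GRing.unit)].

Section Types.
Variables (R : comNzRingType) (p : R).

(* R/(p^l_1) (+) ... (+) R/(p^l_n) *)
Fixpoint cyclic_sum (l : seq nat) : lmodType R :=
  if l is k :: l' then
    (modquot (principal (p ^+ k) : submodClosed R^o) * cyclic_sum l')%type
  else 'rV[R]_0.

Definition has_type (M : lmodType R) (l : seq nat) : Prop :=
  exists f : {linear cyclic_sum l -> M}, bijective f.

End Types.

Section Tableaux.
Local Open Scope nat_scope.

(* Rows and columns are numbered from 0: column j of l has nth 0 l j boxes,
   and the boxes of beta \ gamma in column j are the (r, j) with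
   gamma_j <= r < beta_j.  A filling is a function T of (r, j), of which only
   the values on beta \ gamma matter. *)

Definition is_partition (l : seq nat) : Prop := sorted geq l /\ 0 \notin l.

Definition transpose_part (l : seq nat) (i : nat) : nat :=
  count (fun a => i <= a) l.

Definition in_diagram (l : seq nat) (r j : nat) : bool := r < nth 0 l j.

Definition in_skew (beta gamma : seq nat) (r j : nat) : bool :=
  nth 0 gamma j <= r < nth 0 beta j.

(* The number of entries e in the first m columns. *)
Definition count_left (beta gamma : seq nat) (T : nat -> nat -> nat)
    (m e : nat) : nat :=
  \sum_(j < m) \sum_(nth 0 gamma j <= r < nth 0 beta j) (T r j == e).

Record is_socle_tableau (alpha beta gamma : seq nat)
    (T : nat -> nat -> nat) : Prop := IsSocleTableau {
  st_sub : forall j, nth 0 gamma j <= nth 0 beta j;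
  st_size : sumn alpha + sumn gamma = sumn beta;
  st_pos : forall r j, in_skew beta gamma r j -> 1 <= T r j;
  st_content : forall e, 1 <= e ->
    count_left beta gamma T (size beta) e = transpose_part alpha e;
  st_row : forall r j j', in_skew beta gamma r j -> in_skew beta gamma r j' ->
    j < j' -> T r j' <= T r j;
  st_col : forall r r' j, in_skew beta gamma r j -> in_skew beta gamma r' j ->
    r < r' -> T r' j < T r j;
  st_lattice : forall m e, 1 <= e ->
    count_left beta gamma T m e.+1 <= count_left beta gamma T m e }.

(* sigma is the partition sigma^(i) of the tableau T: its diagram consists of
   the empty boxes and the boxes with entries > i. *)
Definition is_layer (beta gamma : seq nat) (T : nat -> nat -> nat) (i : nat)
    (sigma : seq nat) : Prop :=
  is_partition sigma /\
  forall r j, in_diagram sigma r j =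
    in_diagram gamma r j || in_skew beta gamma r j && (i < T r j).

End Tableaux.

Definition socle_tableau_of (R : comNzRingType) (p : R) (B : lmodType R)
    (A : submodClosed B) (alpha beta gamma : seq nat)
    (T : nat -> nat -> nat) : Prop :=
  [/\ has_type p (submod_type A) alpha, has_type p B beta,
      has_type p (modquot A) gamma &
      forall i, (i <= nth 0%N alpha 0)%N ->
        exists2 sigma, is_layer beta gamma T i sigma &
          has_type p (modquot (soc p i A : submodClosed B)) sigma].

(* Main.v *)
Require Import Defs.
From mathcomp Require Import all_boot all_algebra.
From HB Require Import structures.
From mathcomp Require Import generic_quotient ring_quotient boolp.

(* Work in F = R^n, n the number of columns of beta, with full rank lattices
   L_0 <= L_1 <= ... <= L_s <= F such that F/L_i has type sigma^(i); then
   B = F/L_0 and A = L_s/L_0, and soc^i A = L_i/L_0 as soon as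
   p x in L_i and x in L_(i+2) imply x in L_(i+1).

   L_i is spanned by f^i_j = p^(sigma^(i)_j) e^i_j for a basis e^i of F.  Let
   X_i be the set of columns containing an entry i+1.  By (ST-3) there is an
   injection psi_i : X_(i+1) -> X_i which never moves to the right, is the
   identity on X_i and sends X_(i+1) \ X_i outside X_(i+1).  Put
     f^i_j = p f^(i+1)_j                          for j in X_i,
     f^i_j = f^(i+1)_j - f^(i+1)_(psi_i j)        for j in X_(i+1) \ X_i,
     f^i_j = f^(i+1)_j                            for all other j.
   As psi_i does not move to the right, this change of generators comes from a
   unipotent change of basis of F.

   Modulo L_i, multiplication by p sends f^(i+2)_j, for j in X_(i+1), to
   f^(i+1)_(psi_i j), so the maximal chains of the maps psi_i give a basis of A
   whose orders are the parts of alpha. *)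

Set Implicit Arguments.
Unset Strict Implicit.
Unset Printing Implicit Defensive.

Import GRing.Theory.
Local Open Scope ring_scope.
Local Open Scope quotient_scope.

(** * Projections onto quotients and images of submodules *)

Section Quotients.
Variables (R : comNzRingType) (B : lmodType R) (A : submodClosed B).

Definition modquot_pi (x : B) : modquot A := \pi_({ideal_quot (submod_pred A)}) x.

Fact modquot_pi_linear : linear modquot_pi.
Proof.
move=> c x y.
have -> : modquot_pi (c *: x + y) = modquot_pi (c *: x) + modquot_pi y.
  exact: (@Quotient.pi_add _ (submod_pred A)).
by congr (_ + _); rewrite /modquot_pi -modquot_scale_pi.
Qed.

HB.instance Definition _ :=
  GRing.isLinear.Build R B (modquot A) *:%R modquot_pi modquot_pi_linear.

Lemma modquot_reprK (y : modquot A) :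
  modquot_pi (repr (y : {ideal_quot (submod_pred A)})) = y.
Proof. by rewrite /modquot_pi reprK. Qed.

Lemma modquot_pi_surj (y : modquot A) : exists x, y = modquot_pi x.
Proof.
by exists (repr (y : {ideal_quot (submod_pred A)})); rewrite modquot_reprK.
Qed.

Lemma modquot_pi_eq0 x : (modquot_pi x == 0) = (x \in A).
Proof.
rewrite -(linear0 modquot_pi) /modquot_pi -[LHS]Quotient.idealrBE subr0.
by [].
Qed.

End Quotients.

Section Image.
Variables (R : comNzRingType) (U V : lmodType R) (h : {linear U -> V}).
Variable L : submodClosed U.

Definition lin_image : {pred V} := [pred y | `[< exists2 x, x \in L & y = h x >]].

Lemma lin_imageP y : reflect (exists2 x, x \in L & y = h x) (y \in lin_image).
Proof. exact: asboolP. Qed.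

Fact lin_image_submod_closed : submod_closed lin_image.
Proof.
split=> [|c y z]; first by apply/lin_imageP; exists 0; rewrite ?rpred0 ?linear0.
move=> /lin_imageP[u uL ->] /lin_imageP[v vL ->]; apply/lin_imageP.
by exists (c *: u + v); rewrite ?linearP // rpredD ?rpredZ.
Qed.

HB.instance Definition _ := GRing.isSubmodClosed.Build R V lin_image
  lin_image_submod_closed.

End Image.

(** * Recognizing the type of a module from generators *)

Section TypeCriterion.
Variables (R : comNzRingType) (p : R) (M : lmodType R).

Variables (J : eqType) (a : J -> nat) (x : J -> M).

(** Each summand acts through an arbitrary representative, so linearity requires that [p ^+ a j]
    kill [x j]. *)
Fixpoint cyclic_sum_eval (s : seq J) : cyclic_sum p [seq a j | j <- s] -> M :=
  if s is j :: s' return cyclic_sum p [seq a j | j <- s] -> M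
  then fun y => repr (y.1 : {ideal_quot _}) *: x j + cyclic_sum_eval y.2
  else fun _ => 0.

Lemma modquot_repr_scale (k : nat) (m : M) (c : R) : p ^+ k *: m = 0 ->
  repr (modquot_pi (principal (p ^+ k) : submodClosed R^o) c : {ideal_quot _})
    *: m = c *: m.
Proof.
move=> km0; apply/eqP; rewrite -subr_eq0 -scalerBl.
have : repr (modquot_pi (principal (p ^+ k) : submodClosed R^o) c
    : {ideal_quot _}) - c \in (principal (p ^+ k) : submodClosed R^o).
  by rewrite -modquot_pi_eq0 linearB subr_eq0; apply/eqP; exact: modquot_reprK.
by move=> /asboolP[d ->]; rewrite -scalerA km0 scaler0.
Qed.

Lemma cyclic_sum_eval_linear s : {in s, forall j, p ^+ a j *: x j = 0} ->
  linear (@cyclic_sum_eval s).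
Proof.
elim: s => [|j s IH] ax0 c y z; first by rewrite scaler0 addr0.
rewrite /= IH => [|i si]; last by apply: ax0; rewrite inE si orbT.
have [[u uy] [v vz]] := (modquot_pi_surj y.1, modquot_pi_surj z.1).
have j0 : p ^+ a j *: x j = 0 by apply: ax0; rewrite mem_head.
rewrite uy vz -linearP !modquot_repr_scale //.
rewrite scalerDl -[(c *: u) *: _]scalerA scalerDr -!addrA; congr (_ + _).
by rewrite addrCA.
Qed.

(** Generation makes the evaluation map surjective; the divisibility of the coefficients of every
    relation makes its kernel zero. *)
Lemma has_type_basis s : uniq s ->
    {in s, forall j, p ^+ a j *: x j = 0} ->
    (forall m, exists c : J -> R, m = \sum_(j <- s) c j *: x j) ->
    (forall c : J -> R, \sum_(j <- s) c j *: x j = 0 ->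
      {in s, forall j, exists d, c j = d * p ^+ a j}) ->
  has_type p M [seq a j | j <- s].
Proof.
move=> s_uniq ax0 x_gen x_free.
pose fL := GRing.isLinear.Build R (cyclic_sum p [seq a j | j <- s]) M *:%R
  (@cyclic_sum_eval s) (cyclic_sum_eval_linear ax0).
pose f : {linear cyclic_sum p [seq a j | j <- s] -> M} :=
  HB.pack (@cyclic_sum_eval s) fL.
exists f.
have f_surj m : exists y, f y = m.
  have [c ->] := x_gen m; rewrite {m}/f /= {x_gen x_free fL f}.
  elim: s s_uniq ax0 => [|j s IH] /= s_uniq ax0; first by exists 0; rewrite big_nil.
  have /andP[_ /IH[i si|y yE]] := s_uniq.
    by apply: ax0; rewrite inE si orbT.
  exists (modquot_pi (principal (p ^+ a j) : submodClosed R^o) (c j), y).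
  by rewrite big_cons -yE /= modquot_repr_scale // ax0 ?mem_head.
have f_inj : injective f.
  apply: raddf_inj => y; rewrite /f /= => fy0.
  (* [c] collects representatives of the components of [y], so [y] vanishes once each [c j] is
     divisible by [p ^+ a j]. *)
  have [c [cE cy]] : exists c : J -> R,
      cyclic_sum_eval (s := s) y = \sum_(j <- s) c j *: x j /\
      ({in s, forall j, exists d, c j = d * p ^+ a j} -> y = 0).
    rewrite {x_gen x_free fL f f_surj fy0}.
    elim: s s_uniq ax0 y => [|j s IH] /= s_uniq ax0 y.
      by exists (fun=> 0); rewrite big_nil; split=> // _; apply/rowP => -[].
    have /andP[js us] := s_uniq.
    have [i si|c [cE cy]] := IH us _ y.2; first by apply: ax0; rewrite inE si orbT.
    have [u uy] := modquot_pi_surj y.1.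
    exists (fun i => if i == j then u else c i); split.
      rewrite big_cons eqxx uy modquot_repr_scale ?ax0 ?mem_head // cE.
      congr (_ + _); apply: eq_big_seq => i si; case: eqP => // ij.
      by rewrite -ij si in js.
    move=> cdvd; rewrite [y]surjective_pairing cy => [|i si]; last first.
      have [|d] := cdvd i; first by rewrite inE si orbT.
      case: eqP => [ij|_ ->]; last by exists d.
      by rewrite -ij si in js.
    congr (_, _); rewrite uy; apply/eqP; rewrite modquot_pi_eq0.
    have [|d] := cdvd j; first exact: mem_head.
    by rewrite eqxx => ->; apply/asboolP; exists d.
  by apply: cy; apply: x_free; rewrite -cE.
have [g gK] := choice f_surj.
by exists g => // y; apply: f_inj; rewrite gK.
Qed.

End TypeCriterion.

(** Differences of consecutive counts are the multiplicities of the positive parts; the part 0,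
    invisible to these counts, is excluded. *)
Lemma sorted_geq_eq (l m : seq nat) : sorted geq l -> sorted geq m ->
    0%N \notin l -> 0%N \notin m ->
    (forall e, count (fun a => e < a)%N l = count (fun a => e < a)%N m) ->
  l = m.
Proof.
move=> l_sorted m_sorted l0 m0 lm.
apply: (@sorted_eq _ geq) => //.
- by move=> b a c ab bc; apply: leq_trans bc ab.
- by move=> a b; rewrite andbC; apply: anti_leq.
have lt0 (t : seq nat) : 0%N \notin t -> count_mem 0%N t = 0%N.
  by move=> t0; apply/count_memPn.
have cntS (t : seq nat) e :
    count (fun a => e < a)%N t = (count_mem e.+1 t + count (fun a => e.+1 < a)%N t)%N.
  elim: t => //= a t ->; rewrite addnACA [(e < a)%N]leq_eqVlt eq_sym.
  by case: eqP => [->|_]; rewrite ?ltnn.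
apply/allP => e _; apply/eqP; case: e => [|e]; first by rewrite !lt0.
by apply/(@addIn (count (fun a => e.+1 < a)%N l)); rewrite -cntS lm cntS lm.
Qed.

(** * The generators f^i and the bases e^i *)

Section Lattices.
Variables (R : idomainType) (p : R) (n s : nat).
Variables (X : nat -> pred 'I_n) (psi : nat -> 'I_n -> 'I_n).
Variable sigma : nat -> 'I_n -> nat.
Hypothesis p_neq0 : p != 0.
Hypothesis sigmaE : forall i j, sigma i j = (sigma i.+1 j + X i j)%N.
Hypothesis sigma_anti : forall i (j k : 'I_n),
  (j <= k)%N -> (sigma i k <= sigma i j)%N.
Hypothesis psi_le : forall i k, X i.+1 k -> (psi i k <= k)%N.
Hypothesis psi_in : forall i k, X i.+1 k -> X i (psi i k).
Hypothesis psi_id : forall i k, X i.+1 k -> X i k -> psi i k = k.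
Hypothesis psi_notin : forall i k, X i.+1 k -> ~~ X i k -> ~~ X i.+1 (psi i k).
Hypothesis psi_inj : forall i, {in X i.+1 &, injective (psi i)}.
Hypothesis X_s : X s =1 pred0.

Definition linked i (k j : 'I_n) := [&& X i.+1 k, ~~ X i k & psi i k == j].

Lemma linked_in i k j : linked i k j -> X i j && ~~ X i.+1 j.
Proof. by case/and3P=> Xk Xik /eqP<-; rewrite psi_in // psi_notin. Qed.

Lemma linked_uniq i k k' j : linked i k j -> linked i k' j -> k = k'.
Proof.
case/and3P=> ? _ /eqP kj /and3P[? _ /eqP k'j].
by apply: (@psi_inj i); rewrite // kj.
Qed.

(** Row [k] holds the coordinates of f^i_k in the generators f^(i+1). *)
Definition step_mx i : 'M[R]_n :=
  \matrix_(k, j) (p ^+ X i j *+ (k == j) - (linked i k j)%:R).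

(** The same change read on the bases: [1%:M - link_mx i] takes e^(i+1) to e^i. *)
Definition link_mx i : 'M[R]_n :=
  \matrix_(k, j) (p ^+ (sigma i.+1 j - sigma i.+1 k) *+ linked i k j).

Definition diag_sigma i : 'M[R]_n := diag_mx (\row_j p ^+ sigma i j).

(** Levels descend from [s], where e^s is the standard basis; [d] stands for [s - i]. *)
Fixpoint basis_rec d i : 'M[R]_n :=
  if d is d'.+1 then (1%:M - link_mx i) *m basis_rec d' i.+1 else 1%:M.

Definition basis_mx i := basis_rec (s - i) i.
Definition lat_mx i := diag_sigma i *m basis_mx i.

Lemma basis_mx_unit i : basis_mx i \in unitmx.
Proof.
rewrite /basis_mx; move: (s - i)%N => d; elim: d i => [|d IH] i /=; first exact: unitmx1.
rewrite unitmx_mul IH andbT.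
(* A link starts inside X_(i+1) and ends outside it, so two links never compose; hence 1 - N has
   inverse 1 + N. *)
have NN0 : link_mx i *m link_mx i = 0.
  apply/matrixP=> k j; rewrite !mxE big1 // => l _; rewrite !mxE.
  case kl: (linked i k l); last by rewrite mulr0n mul0r.
  case lj: (linked i l j); last by rewrite mulr0n mulr0.
  by have /andP[_ /negP[]] := linked_in kl; case/and3P: lj.
apply: (proj1 (mulmx1_unit (B := 1%:M + link_mx i) _)).
by rewrite mulmxDr mulmx1 mulmxBl mul1mx NN0 subr0 subrK.
Qed.

Lemma lat_mx_step i : (i < s)%N -> lat_mx i = step_mx i *m lat_mx i.+1.
Proof.
move=> lt_is; rewrite /lat_mx /basis_mx -(subnSK lt_is) /= !mulmxA.
congr (_ *m _); rewrite mul_diag_mx mul_mx_diag.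
apply/matrixP=> k j; rewrite !mxE mulrBr mulrBl; congr (_ - _).
  rewrite mulrnAr mulr1 mulrnAl; case: eqP => [->|_]; last by rewrite !mulr0n.
  by rewrite -exprD addnC -sigmaE.
case kj: (linked i k j); last by rewrite mulr0n mul0r mulr0.
have /and3P[Xk /negPf Xik /eqP kj'] := kj.
(* The subtraction of exponents is exact because psi_i does not move to the right and [sigma]
   decreases along the columns. *)
rewrite mulr1n mul1r -exprD sigmaE Xik addn0 subnKC //.
by apply: sigma_anti; rewrite -kj' psi_le.
Qed.

(** Passes from coordinates in f^i to coordinates in f^(i+1). The next three lemmas treat [j]
    outside X_i, [j] in both strips, and [j] the end of a link, which is unique by injectivity. *)
Lemma step_mxE i (v : 'rV_n) j : (v *m step_mx i) 0 j =
  p ^+ X i j * v 0 j - \sum_(k | linked i k j) v 0 k.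
Proof.
rewrite mxE [in RHS]big_mkcond /= -[p ^+ _ * _](_
   : \sum_k (v 0 k * (p ^+ X i j *+ (k == j))) = _).
  rewrite -sumrB; apply: eq_bigr => k _; rewrite mxE mulrBr.
  by case: (linked i k j); rewrite ?mulr1 ?mulr0.
rewrite (bigD1 j) //= eqxx mulr1n mulrC big1 ?addr0 // => k /negPf->.
by rewrite mulr0n mulr0.
Qed.

Lemma step_mx_notin i (v : 'rV_n) j : ~~ X i j -> (v *m step_mx i) 0 j = v 0 j.
Proof.
move=> Xj; rewrite step_mxE (negPf Xj) mul1r big1 ?subr0 // => k /linked_in.
by rewrite (negPf Xj).
Qed.

Lemma step_mx_next i (v : 'rV_n) j :
  X i j -> X i.+1 j -> (v *m step_mx i) 0 j = p * v 0 j.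
Proof.
move=> Xj X1j; rewrite step_mxE Xj big1 ?subr0 // => k /linked_in.
by rewrite X1j andbF.
Qed.

Lemma step_mx_linked i (v : 'rV_n) k j :
  linked i k j -> (v *m step_mx i) 0 j = p * v 0 j - v 0 k.
Proof.
move=> kj; have /andP[Xj _] := linked_in kj.
rewrite step_mxE Xj (bigD1 k) //= big1 ?addr0 // => l /andP[lj].
by rewrite (linked_uniq lj kj) eqxx.
Qed.

Lemma step_mx_row_notin i k : ~~ linked i k (psi i k) ->
  row k (step_mx i) = p ^+ X i k *: delta_mx 0 k.
Proof.
move=> nk; apply/rowP=> j; rewrite !mxE /= eq_sym.
have -> : linked i k j = false.
  apply: contraNF nk => kj; have /and3P[_ _ /eqP->] := kj; exact: kj.
rewrite subr0; case: eqP => [->|_]; first by rewrite mulr1.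
by rewrite mulr0.
Qed.

Lemma step_mx_row_linked i k : linked i k (psi i k) ->
  row k (step_mx i) = delta_mx 0 k - delta_mx 0 (psi i k).
Proof.
move=> kj; have /and3P[X1k /negPf Xk _] := kj; apply/rowP=> j; rewrite !mxE /=.
rewrite /linked X1k Xk /= !(eq_sym j); congr (_ - _).
by case: eqP => // <-; rewrite Xk.
Qed.

Lemma lat_mx_inj i (v w : 'rV_n) : v *m lat_mx i = w *m lat_mx i -> v = w.
Proof.
rewrite /lat_mx !mulmxA => /(can_inj (mulmxK (basis_mx_unit i))).
rewrite !mul_mx_diag => /rowP vw; apply/rowP=> j.
move: (vw j); rewrite !mxE; apply: mulIf.
by rewrite expf_neq0.
Qed.

(** * The filtration by the L_i and the socles *)

Definition lat i : {pred 'rV[R]_n} := [pred x | `[< exists v, x = v *m lat_mx i >]].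

Fact lat_submod_closed i : submod_closed (lat i).
Proof.
split=> [|c x y]; first by apply/asboolP; exists 0; rewrite mul0mx.
move=> /asboolP[v ->] /asboolP[w ->]; apply/asboolP; exists (c *: v + w).
by rewrite mulmxDl scalemxAl.
Qed.

HB.instance Definition _ i := GRing.isSubmodClosed.Build R 'rV[R]_n (lat i)
  (lat_submod_closed i).

Lemma mem_lat i v : v *m lat_mx i \in lat i.
Proof. by apply/asboolP; exists v. Qed.

Lemma row_lat i k : row k (lat_mx i) \in lat i.
Proof. by rewrite rowE mem_lat. Qed.

Lemma latP i x : reflect (exists v, x = v *m lat_mx i) (x \in lat i).
Proof. exact: asboolP. Qed.

Lemma lat_succ i : (i < s)%N -> {subset lat i <= lat i.+1}.
Proof. by move=> lt_is x /latP[v ->]; rewrite lat_mx_step // mulmxA mem_lat. Qed.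

Lemma lat_sub i k : (i <= k <= s)%N -> {subset lat i <= lat k}.
Proof.
case/andP; elim: k => [|k IH]; first by rewrite leqn0 => /eqP-> _ x.
rewrite leq_eqVlt => /predU1P[-> _ x //|]; rewrite ltnS => le_ik lt_ks x xi.
by apply: lat_succ => //; apply: IH; rewrite // ltnW.
Qed.

Lemma lat_scale i x : (i < s)%N -> x \in lat i.+1 -> p *: x \in lat i.
Proof.
move=> lt_is /latP[v ->]; apply/latP.
(* Off X_i coordinates are copied, which forces p v_j; on X_i the added v_k compensates for a link
   from k, whose coordinate is p v_k. *)
exists (\row_j if X i j then v 0 j + \sum_(k | linked i k j) v 0 k else p * v 0 j).
rewrite (lat_mx_step lt_is) mulmxA scalemxAl; congr (_ *m _).
apply/rowP=> j; rewrite step_mxE !mxE.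
have [Xj|Xj] := boolP (X i j); last first.
  rewrite mul1r big1 ?subr0 // => k /linked_in; by rewrite (negPf Xj).
rewrite mulrDr -addrA [X in _ = _ + X](_ : _ = 0) ?addr0 //.
rewrite -[X in X + _](_ : \sum_(k | linked i k j) p * v 0 k = _) ?mulr_sumr //.
rewrite -sumrB big1 // => k /and3P[_ /negPf Xk _]; by rewrite mxE Xk subrr.
Qed.

(** With [u] the coordinates of p x in f^(i+1), it suffices that p divides every u_j: the quotients
    are then coordinates of x in f^(i+1). *)
Lemma lat_socle_step i x : (i.+1 < s)%N ->
  x \in lat i.+2 -> p *: x \in lat i -> x \in lat i.+1.
Proof.
move=> lt_is /latP[v ->] /latP[w].
have lt_is' := ltnW lt_is.
rewrite (lat_mx_step lt_is') (lat_mx_step lt_is) [RHS]mulmxA scalemxAl.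
rewrite [_ *m (step_mx _ *m _)]mulmxA => /lat_mx_inj.
set u := w *m step_mx i => pv.
have pdvd j : exists d, u 0 j = p * d.
  have pvE k : (u *m step_mx i.+1) 0 k = p * v 0 k by rewrite -pv mxE.
  have [X1j|X1j] := boolP (X i.+1 j); last first.
    by exists (v 0 j); rewrite -pvE step_mx_notin.
  have [Xj|Xj] := boolP (X i j).
    by exists (w 0 j); rewrite /u step_mx_next.
  (* Here u_j = w_j. At k = psi_i j, the two values p w_k - w_j and p v_k of u_k give w_j = p (w_k -
     v_k). *)
  have jk : linked i j (psi i j) by rewrite /linked X1j Xj /=.
  rewrite /u step_mx_notin //.
  exists (w 0 (psi i j) - v 0 (psi i j)); rewrite mulrBr -pvE.
  have /andP[_ X1k] := linked_in jk.
  by rewrite step_mx_notin // /u (step_mx_linked _ jk) opprB addrC subrK.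
have [d /= dE] := choice pdvd.
suff -> : v = \row_j d j *m step_mx i.+1 by rewrite -mulmxA -lat_mx_step ?mem_lat.
have : p *: v = p *: (\row_j d j *m step_mx i.+1).
  rewrite pv scalemxAl; congr (_ *m _).
  by apply/rowP=> j; rewrite dE !mxE.
move=> /rowP vE; apply/rowP=> j; apply: (mulfI p_neq0).
by move: (vE j); rewrite mxE [RHS]mxE.
Qed.

Lemma lat_socle i x : (i <= s)%N ->
  (x \in lat i) = (x \in lat s) && (p ^+ i *: x \in lat 0).
Proof.
move=> le_is; apply/idP/andP => [xi|[]].
  split; first by apply: (@lat_sub i); rewrite ?le_is ?leqnn.
  elim: i x le_is xi => [|i IH] x le_is xi; first by rewrite scale1r.
  by rewrite exprSr -scalerA IH ?lat_scale // ltnW.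
(* Induction on [i]: the hypothesis for p x places p x in L_(m-2), and then [lat_socle_step] lowers
   x to L_(m-1). *)
have descend m : (i < m <= s)%N -> x \in lat m -> p ^+ i *: x \in lat 0 ->
    x \in lat m.-1.
  move=> {le_is}; elim: i m x => [|i IH] [|m] x //=.
    rewrite scale1r => lt_ms _ x0.
    by apply: (@lat_sub 0) x0; rewrite leq0n ltnW.
  case: m => // m /andP[lt_im lt_ms] xm px.
  apply: lat_socle_step => //; apply: (IH m.+1); first exact/andP/(conj lt_im)/ltnW.
    exact: lat_scale.
  by rewrite scalerA -exprSr.
move=> xs px; move: xs; have := leqnn s; rewrite -{1 3}(subnKC le_is).
elim: (s - i)%N => [|d IH] le_s; first by rewrite addn0.
rewrite addnS => /descend xd; apply: IH; first by rewrite ltnW // -addnS.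
by apply: xd; rewrite // ltnS leq_addr -addnS.
Qed.

(** * Types of the quotients F/L_i *)

Lemma row_lat_mx i j : row j (lat_mx i) = p ^+ sigma i j *: row j (basis_mx i).
Proof. by rewrite /lat_mx row_mul row_diag_mx -scalemxAl -rowE mxE. Qed.

(** As f^i_j = p^(sigma^(i)_j) e^i_j, the images of the e^i_j satisfy the type criterion. Any
    surjection with kernel L_i is allowed, which covers both B and its quotients. *)
Lemma has_type_lat_quot i (M : lmodType R) (h : {linear 'rV[R]_n -> M})
    (l : seq nat) :
    (forall m, exists x, m = h x) -> (forall x, (h x == 0) = (x \in lat i)) ->
    (size l <= n)%N -> (forall j : 'I_n, nth 0%N l j = sigma i j) ->
  has_type p M l.
Proof.
move=> h_surj h_ker le_ln lE.
pose S := [seq j : 'I_n <- enum 'I_n | (j < size l)%N].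
have S_val : map val S = iota 0 (size l).
  rewrite -(filter_map val (fun j => j < size l)%N) val_enum_ord.
  exact: (filter_iota_ltn 0 le_ln).
have mapS : [seq sigma i j | j <- S] = l.
  rewrite -[RHS](mkseq_nth 0%N) /mkseq -S_val -map_comp.
  by apply: eq_map => j; rewrite /= lE.
have sig0 (j : 'I_n) : ~~ (j < size l)%N -> sigma i j = 0%N.
  by rewrite -leqNgt -lE => ?; apply: nth_default.
have mem_S (j : 'I_n) : (j \in S) = (j < size l)%N by rewrite mem_filter mem_enum andbT.
have sumS c : \sum_(j <- S) c j *: h (row j (basis_mx i)) =
    h ((\row_j (if (j < size l)%N then c j else 0)) *m basis_mx i).
  rewrite mulmx_sum_row linear_sum big_filter big_enum_cond big_mkcond /=.
  apply: eq_bigr => j _; rewrite mxE linearZ /=.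
  by case: ifP => //; rewrite scale0r.
rewrite -mapS; apply: (@has_type_basis _ p M _ _ (fun j => h (row j (basis_mx i)))).
- by rewrite filter_uniq ?enum_uniq.
- move=> j _; apply/eqP; rewrite -linearZ -row_lat_mx h_ker; exact: row_lat.
- move=> m; have [x ->] := h_surj m.
  exists (fun j => (x *m invmx (basis_mx i)) 0 j).
  rewrite sumS; apply/eqP; rewrite -subr_eq0 -linearB h_ker.
  rewrite -{1}[x](mulmxKV (basis_mx_unit i)) -mulmxBl mulmx_sum_row.
  apply: rpred_sum => j _; rewrite !mxE; case: ifP => lt_j.
    by rewrite subrr scale0r rpred0.
  (* Beyond the length of [l] the exponent is 0, so the basis vector itself lies in L_i. *)
  have := row_lat i j; rewrite row_lat_mx sig0 ?lt_j // scale1r => bj.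
  by rewrite rpredZ.
- move=> c; rewrite sumS => /eqP; rewrite h_ker => /latP[w].
  rewrite /lat_mx mulmxA => /(can_inj (mulmxK (basis_mx_unit i))) /rowP cw j.
  by rewrite mem_S => lt_j; exists (w 0 j); move: (cw j); rewrite mul_mx_diag !mxE lt_j.
Qed.

(** * Chains of generators and the type of A *)

(* x j generates the chain ending at the column j of X i, of length a j; the
   last clause counts the chains of length greater than e. *)
Definition chain_system i (a : 'I_n -> nat) (x : 'I_n -> 'rV[R]_n) :=
  [/\ forall j, X i j -> (0 < a j)%N /\ x j \in lat s,
      forall j, X i j -> p ^+ (a j).-1 *: x j - row j (lat_mx i.+1) \in lat i,
      forall y, y \in lat s -> exists c : 'I_n -> R,
        y - \sum_(j | X i j) c j *: x j \in lat i,
      forall c : 'I_n -> R, \sum_(j | X i j) c j *: x j \in lat i ->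
        forall j, X i j -> exists d, c j = d * p ^+ a j &
      forall e, #|[set j | X i j && (e < a j)%N]| = #|[set j | X (i + e)%N j]|].

(** With the next lemma: the f^(i+1)_j, for j in X_i, give a basis of L_(i+1)/L_i over R/(p).
    Subtracting the element of L_i with coordinates [w] clears the coordinates outside X_i. *)
Lemma rows_lat_succ_gen i v : (i < s)%N -> exists c : 'I_n -> R,
  v *m lat_mx i.+1 - \sum_(j | X i j) c j *: row j (lat_mx i.+1) \in lat i.
Proof.
move=> lt_is; pose w : 'rV_n := \row_j (if X i j then 0 else v 0 j).
exists (fun j => (v - w *m step_mx i) 0 j).
rewrite big_mkcond /=.
rewrite (eq_bigr (fun j => (v - w *m step_mx i) 0 j *: row j (lat_mx i.+1))).
  by rewrite -mulmx_sum_row -mulmxBl opprB addrC subrK -mulmxA -lat_mx_step ?mem_lat.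
move=> j _; case: ifPn => // Xj; rewrite mxE [X in _ + X]mxE step_mx_notin //.
by rewrite mxE (negPf Xj) subrr scale0r.
Qed.

Lemma rows_lat_succ_free i (c : 'I_n -> R) : (i < s)%N ->
    \sum_(j | X i j) c j *: row j (lat_mx i.+1) \in lat i ->
  forall j, X i j -> exists d, c j = d * p.
Proof.
move=> lt_is; pose v : 'rV_n := \row_j (if X i j then c j else 0).
have -> : \sum_(j | X i j) c j *: row j (lat_mx i.+1) = v *m lat_mx i.+1.
  rewrite mulmx_sum_row big_mkcond; apply: eq_bigr => j _.
  by rewrite mxE; case: ifP => //; rewrite scale0r.
move=> /latP[w]; rewrite (lat_mx_step lt_is) mulmxA => /lat_mx_inj vE j Xj.
have w0 k : ~~ X i k -> w 0 k = 0.
  by move=> Xk; rewrite -(step_mx_notin w Xk) -vE mxE (negPf Xk).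
have -> : c j = v 0 j by rewrite mxE Xj.
(* Links start outside X_i, where [w] vanishes, so only p w_j remains. *)
exists (w 0 j); rewrite vE step_mxE Xj mulrC big1 ?subr0 // => k /and3P[_ Xk _].
exact: w0.
Qed.

(** Since psi_i maps X_(i+1) into X_i, emptiness propagates upwards from X_s. *)
Lemma X_ge_s i j : (s <= i)%N -> ~~ X i j.
Proof.
move=> /subnKC <-; elim: (i - s)%N j => [|d IH] j; first by rewrite addn0 X_s.
by rewrite addnS; apply: contra (IH (psi (s + d) j)) => /psi_in.
Qed.

Lemma chain_system_top : exists a x, chain_system s a x.
Proof.
exists (fun=> 0%N), (fun=> 0); split=> [j|j|y ys|c _ j|e]; rewrite ?X_s //.
  by exists (fun=> 0); rewrite big_pred0 ?subr0.
apply: eq_card => j; rewrite !inE X_s; apply/esym/negbTE/X_ge_s; exact: leq_addr.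
Qed.

(** For k in X_(i+1), p f^(i+2)_k = f^(i+1)_k, and this differs from f^(i+1)_(psi_i k) by 0 or by
    f^i_k. *)
Lemma row_lat_psi i k : (i.+1 < s)%N -> X i.+1 k ->
  p *: row k (lat_mx i.+2) - row (psi i k) (lat_mx i.+1) \in lat i.
Proof.
move=> lt_is X1k; have lt_is' := ltnW lt_is.
have <- : row k (lat_mx i.+1) = p *: row k (lat_mx i.+2).
  rewrite (lat_mx_step lt_is) row_mul step_mx_row_notin; last first.
    by apply/negP=> /and3P[_]; rewrite X1k.
  by rewrite X1k -scalemxAl -rowE.
have [Xk|Xk] := boolP (X i k); first by rewrite psi_id // subrr rpred0.
have kj : linked i k (psi i k) by rewrite /linked X1k Xk /=.
rewrite !rowE -mulmxBl -(step_mx_row_linked kj) -row_mul -lat_mx_step //.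
exact: row_lat.
Qed.

(** The chain ending at k in X_(i+1) keeps its generator and is prolonged to psi_i k; each column of
    X_i outside the image of psi_i starts a chain of length 1. *)
Lemma chain_system_step i a x : (i < s)%N ->
  chain_system i.+1 a x -> exists a' x', chain_system i a' x'.
Proof.
move=> lt_is [a_pos x_row x_gen x_free a_card].
pose Y := [set psi i k | k in X i.+1].
pose inv j := [pick k | X i.+1 k && (psi i k == j)].
have invK k : X i.+1 k -> inv (psi i k) = Some k.
  move=> X1k; rewrite /inv; case: pickP => [k' /andP[X1k' /eqP e]|/(_ k)].
    by congr Some; apply: (@psi_inj i).
  by rewrite X1k eqxx.
have invN j : j \notin Y -> inv j = None.
  rewrite /inv; case: pickP => // k /andP[X1k /eqP <-] /negP[].
  by apply/imsetP; exists k.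
have YX j : j \in Y -> X i j by case/imsetP=> k X1k ->; apply: psi_in.
pose a' j := if inv j is Some k then (a k).+1 else 1%N.
pose x' j := if inv j is Some k then x k else row j (lat_mx i.+1).
have a'psi k : X i.+1 k -> a' (psi i k) = (a k).+1 by move=> X1k; rewrite /a' invK.
have x'psi k : X i.+1 k -> x' (psi i k) = x k by move=> X1k; rewrite /x' invK.
have a'N j : j \notin Y -> a' j = 1%N by move=> jY; rewrite /a' invN.
have x'N j : j \notin Y -> x' j = row j (lat_mx i.+1).
  by move=> jY; rewrite /x' invN.
have sumX (F : 'I_n -> 'rV[R]_n) : \sum_(j | X i j) F j =
    \sum_(k | X i.+1 k) F (psi i k) + \sum_(j | X i j && (j \notin Y)) F j.
  rewrite (bigID (mem Y)) /=; congr (_ + _).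
  rewrite -(big_imset _ (@psi_inj i)) /=; apply: eq_bigl => j.
  by rewrite andbC; case jY: (j \in Y) => //=; apply: YX.
have X1_lt k : X i.+1 k -> (i.+1 < s)%N.
  by rewrite ltn_neqAle lt_is andbT; case: eqP => // ->; rewrite X_s.
have x'_row j : X i j -> p ^+ (a' j).-1 *: x' j - row j (lat_mx i.+1) \in lat i.
  move=> Xj; have [/imsetP[k X1k ->]|jY] := boolP (j \in Y); last first.
    by rewrite a'N // x'N // scale1r subrr rpred0.
  have [a_gt0 _] := a_pos k X1k.
  rewrite a'psi // x'psi //= -(prednK a_gt0) exprS -scalerA.
  rewrite -[X in X - _](subrK (p *: row k (lat_mx i.+2))) -scalerBr -addrA.
  by rewrite rpredD ?row_lat_psi ?lat_scale ?x_row ?(X1_lt k).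
exists a', x'; split=> //.
- move=> j Xj; have [/imsetP[k X1k ->]|jY] := boolP (j \in Y).
    by rewrite a'psi // x'psi //; split=> //; have [] := a_pos k X1k.
  rewrite a'N // x'N //; split=> //; apply: (@lat_sub i.+1).
    by rewrite lt_is leqnn.
  exact: row_lat.
- move=> y /x_gen[c /latP[v yE]].
  have [c' c'E] := rows_lat_succ_gen v lt_is.
  (* The first term reduces y to L_(i+1) by the old chains; the second removes the rest, with p^(a'
     j - 1) x'_j in place of f^(i+1)_j. *)
  exists (fun j => oapp c 0 (inv j) + c' j * p ^+ (a' j).-1).
  under eq_bigr do rewrite scalerDl -scalerA.
  rewrite big_split /= opprD addrA.
  have -> : \sum_(j | X i j) oapp c 0 (inv j) *: x' j =
      \sum_(j | X i.+1 j) c j *: x j.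
    rewrite sumX [X in _ + X]big1 ?addr0 => [|j /andP[_ /invN->]]; last first.
      by rewrite scale0r.
    by apply: eq_bigr => k X1k; rewrite invK // x'psi.
  rewrite yE -[X in X - _](subrK (\sum_(j | X i j) c' j *: row j (lat_mx i.+1))).
  rewrite -addrA rpredD // -sumrB rpred_sum // => j Xj.
  by rewrite -scalerBr rpredZ // -opprB rpredN x'_row.
- move=> c cx j Xj.
  (* Modulo L_(i+1) only the old chains survive and give all factors p but one; the last one comes
     from the freeness of the f^(i+1)_j modulo L_i. *)
  have cdvd k : exists d, X i k -> c k = d * p ^+ (a' k).-1.
    have [Xk|Xk] := boolP (X i k); last by exists 0.
    have [/imsetP[l X1l kE]|kY] := boolP (k \in Y); last first.
      by exists (c k); rewrite a'N // mulr1.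
    have [|d dE] := x_free (c \o psi i) _ l X1l; last first.
      by exists d; rewrite kE a'psi.
    have := lat_succ lt_is cx; rewrite sumX rpredDr.
      rewrite (eq_bigr (fun k => (c \o psi i) k *: x k)) // => m X1m.
      by rewrite x'psi.
    by apply: rpred_sum => m /andP[_ mY]; rewrite x'N // rpredZ ?row_lat.
  have [d dE] := choice cdvd.
  have [|e dj] := @rows_lat_succ_free i d lt_is _ j Xj; last first.
    exists e; rewrite dE // dj -mulrA -exprS prednK //.
    by rewrite /a'; case: (inv j).
  rewrite -[X in X \in _](subKr (\sum_(k | X i k) c k *: x' k)) rpredB //.
  rewrite -sumrB rpred_sum // => k Xk.
  by rewrite dE // -scalerA -scalerBr rpredZ ?x'_row.
- case=> [|e].
    rewrite addn0; apply: eq_card => j; rewrite !inE andbC /a'.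
    by case: (inv j).
  (* Chains longer than e+1 are exactly the prolongations of old chains longer than e. *)
  rewrite addnS -addSn -a_card -[RHS](card_in_imset (f := psi i)); last first.
    by move=> k l; rewrite !inE => /andP[X1k _] /andP[X1l _]; exact: psi_inj X1k X1l.
  apply: eq_card => j; rewrite inE; apply/andP/imsetP => [[Xj]|[k]].
    have [/imsetP[k X1k ->]|jY] := boolP (j \in Y); last by rewrite a'N.
    by rewrite a'psi // ltnS => ?; exists k => //; rewrite inE; apply/andP.
  by rewrite inE => /andP[X1k lt_e] ->; rewrite a'psi ?ltnS ?psi_in.
Qed.

Lemma chain_system_exists i : (i <= s)%N -> exists a x, chain_system i a x.
Proof.
move=> le_is; rewrite -(subKn le_is).
elim: (s - i)%N (leq_subr i s) => [|d IH] lt_ds.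
  by rewrite subn0; exact: chain_system_top.
have [|a [x ax]] := IH; first exact: ltnW.
apply: (@chain_system_step _ a x); first by rewrite ltn_subrL (leq_ltn_trans _ lt_ds).
by rewrite subnSK.
Qed.

(** B = F/L_0 and A = L_s/L_0. The chains at level 0 form a basis of A, and as many of them as parts
    of [alpha] exceed e, namely |X_e|, so their sorted lengths are [alpha]. *)
Lemma lat_embedding (alpha : seq nat) : sorted geq alpha -> 0%N \notin alpha ->
    (forall e, transpose_part alpha e.+1 = #|[set j | X e j]|) ->
  exists (B : lmodType R) (h : {linear 'rV[R]_n -> B}) (A : submodClosed B),
  [/\ forall b, exists x, b = h x, forall x, (h x == 0) = (x \in lat 0),
     forall x, (h x \in A) = (x \in lat s) & has_type p (submod_type A) alpha].
Proof.
move=> alpha_sorted alpha_pos alphaE.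
pose h : {linear 'rV[R]_n -> modquot (lat 0)} := modquot_pi (lat 0).
have h_ker x : (h x == 0) = (x \in lat 0) by exact: modquot_pi_eq0.
pose A : submodClosed (modquot (lat 0)) := lin_image h (lat s).
have hA x : (h x \in A) = (x \in lat s).
  apply/lin_imageP/idP => [[y ys]|xs]; last by exists x.
  move=> /eqP; rewrite -subr_eq0 -linearB h_ker => xy0.
  by rewrite -(subrK y x) rpredD // (@lat_sub 0 s) ?leqnn.
exists (modquot (lat 0)), h, A; split=> //; first exact: modquot_pi_surj.
have [a [x [x_pos x_row x_gen x_free x_card]]] := chain_system_exists (leq0n s).
pose S := sort (fun j k => geq (a j) (a k)) (enum (X 0)).
have mem_S j : (j \in S) = X 0 j by rewrite mem_sort mem_enum.
have aS : [seq a j | j <- S] = alpha.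
  apply: sorted_geq_eq => //.
  - rewrite sorted_map; apply: sort_sorted => j k; exact: leq_total.
  - by apply/mapP=> -[j]; rewrite mem_S => /x_pos[a_gt0 _] a0; rewrite -a0 in a_gt0.
  - move=> e; rewrite [RHS]alphaE -x_card count_map.
    rewrite (permP (permEl (perm_sort _ _))) -sum1_count big_enum_cond -sum1_card.
    by apply: eq_bigl => j; rewrite !inE.
pose xA j : submod_type A := insubd 0 (h (x j)).
have val_xA j : X 0 j -> val (xA j) = h (x j).
  by move=> Xj; rewrite val_insubd hA; have [_ ->] := x_pos j Xj.
have sumA c : val (\sum_(j <- S) c j *: xA j) = h (\sum_(j | X 0 j) c j *: x j).
  rewrite raddf_sum linear_sum /= (perm_big _ (permEl (perm_sort _ _))) /=.
  rewrite big_enum /=; apply: eq_bigr => j Xj.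
  by rewrite linearZ /= val_xA // linearZ.
rewrite -aS; apply: (@has_type_basis _ p _ _ _ xA).
- by rewrite sort_uniq enum_uniq.
- move=> j; rewrite mem_S => Xj; apply: val_inj; rewrite linearZ /= val_xA //.
  have [a_gt0 _] := x_pos j Xj.
  rewrite -linearZ; apply/eqP; rewrite h_ker -(prednK a_gt0) exprS -scalerA.
  have lt_0s : (0 < s)%N by rewrite ltnNge; apply/negP => /(@X_ge_s _ j)/negP.
  (* p^(a j - 1) x_j is f^1_j modulo L_0, and p L_1 lies in L_0. *)
  rewrite -[X in p *: X](subrK (row j (lat_mx 1))) scalerDr.
  by apply: rpredD; [apply/rpredZ/x_row|apply: lat_scale; rewrite ?row_lat].
- move=> y; have /lin_imageP[z zs yE] := valP y.
  have [c zc] := x_gen z zs; exists c; apply: val_inj; rewrite sumA yE.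
  by apply/eqP; rewrite -subr_eq0 -linearB h_ker.
- move=> c /(congr1 val); rewrite sumA linear0 => /eqP; rewrite h_ker => cx j.
  by rewrite mem_S; apply: x_free.
Qed.
End Lattices.

(** * Matching the columns of consecutive strips *)

Lemma exists_matching (X Y : pred nat) n :
    (forall m, count Y (iota 0 m) <= count X (iota 0 m))%N ->
  exists psi : nat -> nat,
    {in [pred k | (k < n)%N && Y k] &, injective psi} /\
    forall k, (k < n)%N -> Y k ->
      [/\ (psi k <= k)%N, X (psi k), X k -> psi k = k & ~~ X k -> ~~ Y (psi k)].
Proof.
move=> leYX; elim: n => [|n [psi [psi_inj psiP]]]; first by exists id.
suff [j [le_jn Xj jn jY j_new]] : exists j, [/\ (j <= n)%N, Y n -> X j,
    Y n -> X n -> j = n, Y n -> ~~ X n -> ~~ Y j &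
    forall k, (k < n)%N -> Y k -> Y n -> psi k <> j].
  exists (fun k => if k == n then j else psi k); split.
    move=> k l; rewrite !inE !ltnS => /andP[le_kn Yk] /andP[le_ln Yl].
    case: eqP => [kn|/eqP kn]; case: eqP => [ln|/eqP ln] //.
    - by rewrite kn ln.
    - move=> jl; case: (j_new l) => //; first by rewrite ltn_neqAle ln.
      by rewrite -kn.
    - move=> jk; case: (j_new k) => //; first by rewrite ltn_neqAle kn.
      by rewrite -ln.
    - by apply: psi_inj; rewrite inE ltn_neqAle ?kn ?ln ?le_kn ?le_ln.
  move=> k; rewrite ltnS => le_kn Yk; case: eqP => [kn|/eqP kn].
    by move: Yk; rewrite kn => Yn; split; auto.
  by apply: psiP; rewrite // ltn_neqAle kn.
have [Yn|nYn] := boolP (Y n); last by exists n; split=> //; case/negP: nYn.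
have [Xn|nXn] := boolP (X n).
  exists n; split=> // k lt_kn Yk _ kn.
  by have [+ _ _ _] := psiP k lt_kn Yk; rewrite kn leqNgt lt_kn.
pose a := [seq j <- iota 0 n | X j && ~~ Y j].
pose c := [seq j <- iota 0 n | Y j && ~~ X j].
(* As n lies in Y but not in X, the count inequality at n+1 is strict on the columns before n, and
   stays so after removing the common columns. *)
have lt_ca : (size c < size a)%N.
  have := leYX n.+1; rewrite -addn1 iotaD !count_cat /= Yn (negPf nXn) addn0 addn1.
  rewrite !size_filter; have split_count (Q Z : pred nat) t :
      count Q t = (count (predI Q Z) t + count (fun j => Q j && ~~ Z j) t)%N.
    elim: t => //= j t ->; rewrite addnACA; congr (_ + _)%N.
    by case: (Q j); case: (Z j).
  rewrite (split_count Y X) (split_count X Y) -addnS.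
  have /eq_count-> : predI Y X =1 predI X Y by move=> j; rewrite /= andbC.
  by rewrite !addn0 leq_add2l.
have /allPn[j] : ~~ all (mem (map psi c)) a.
  apply/negP => /allP a_sub; move: lt_ca; rewrite ltnNge -(size_map psi c) => /negP[].
  by apply: uniq_leq_size; rewrite ?filter_uniq ?iota_uniq.
rewrite mem_filter mem_iota => /andP[/andP[Xj nYj] /= lt_jn] j_new.
exists j; split=> //; first exact: ltnW.
move=> k lt_kn Yk _ kj; case/negP: j_new; apply/mapP; exists k => //.
rewrite mem_filter mem_iota Yk lt_kn /= andbT; apply/negP => Xk.
by have [_ _ /(_ Xk) kk _] := psiP k lt_kn Yk; rewrite -kj kk Yk in nYj.
Qed.

(** * Downward closed sets of rows *)

Lemma initial_segment a b (P : pred nat) : (a <= b)%N ->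
    (forall r r', (a <= r)%N -> (r < r' < b)%N -> P r' -> P r) ->
  exists2 m, (a <= m <= b)%N & forall r, (a <= r < b)%N -> P r = (r < m)%N.
Proof.
elim: b => [|b IH]; first by rewrite leqn0 => /eqP-> _; exists 0%N.
rewrite leq_eqVlt => /predU1P[-> _|].
  by exists b.+1; rewrite ?leqnn // => r /andP[le_b]; rewrite ltnNge le_b.
rewrite ltnS => le_ab Pclosed; have [Pb|nPb] := boolP (P b).
  exists b.+1; first by rewrite leqnn leqW.
  move=> r /andP[le_ar]; rewrite ltnS => le_rb; rewrite le_rb.
  move: le_rb; rewrite leq_eqVlt => /predU1P[-> //|lt_rb].
  by apply: Pclosed Pb; rewrite // lt_rb ltnS leqnn.
have [r r' le_ar /andP[lt_r lt_r'b]|m /andP[le_am le_mb] mP] := IH le_ab.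
  by apply: (Pclosed _ r'); rewrite // lt_r ltnW.
exists m; first by rewrite le_am leqW.
move=> r /andP[le_ar]; rewrite ltnS leq_eqVlt => /predU1P[->|lt_rb].
  by rewrite (negPf nPb) ltnNge le_mb.
by rewrite mP // le_ar.
Qed.

Lemma ltn_initial_count a b (P : pred nat) : (a <= b)%N ->
    (forall r r', (a <= r)%N -> (r < r' < b)%N -> P r' -> P r) ->
  forall r, (r < a + \sum_(a <= k < b) P k)%N = (r < a)%N || (a <= r < b)%N && P r.
Proof.
move=> le_ab /(initial_segment le_ab)[m /andP[le_am le_mb] mP] r.
have -> : (a + \sum_(a <= k < b) P k = m)%N.
  rewrite (big_cat_nat le_am le_mb) /=.
  rewrite (eq_big_nat _ _ (F2 := fun=> 1%N)); last first.
    by move=> k /andP[le_ak lt_km]; rewrite mP ?lt_km // le_ak (leq_trans lt_km).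
  rewrite [X in (_ + (_ + X))%N](eq_big_nat _ _ (F2 := fun=> 0%N)); last first.
    by move=> k /andP[le_mk lt_kb]; rewrite mP ?lt_kb ?(leq_trans le_am) // ltnNge le_mk.
  by rewrite sum_nat_const_nat muln1 big1 // addn0 subnKC.
case: (ltnP r a) => [lt_ra|le_ar] /=; first exact: leq_trans lt_ra le_am.
case: (ltnP r b) => [lt_rb|le_br] /=; first by rewrite mP // le_ar.
by rewrite ltnNge (leq_trans le_mb).
Qed.

(** * Layers and strips of a socle tableau *)

Section SocleTableau.
Local Open Scope nat_scope.
Variables (alpha beta gamma : seq nat) (T : nat -> nat -> nat).
Hypotheses (alpha_part : is_partition alpha) (beta_part : is_partition beta).
Hypothesis gamma_part : is_partition gamma.
Hypothesis T_st : is_socle_tableau alpha beta gamma T.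

Lemma nth_partition_anti l j k : is_partition l -> j <= k -> nth 0 l k <= nth 0 l j.
Proof.
move=> [l_sorted _]; rewrite leq_eqVlt => /predU1P[-> //|lt_jk].
have [le_lk|lt_kl] := leqP (size l) k; first by rewrite [nth 0 l k]nth_default.
apply: (sorted_ltn_nth (leT := geq)) => //; last exact: ltn_trans lt_kl.
by move=> b a c ab bc; apply: leq_trans bc ab.
Qed.

(** The height of column [j] of sigma^(i). *)
Definition layer_col i j : nat :=
  nth 0 gamma j + \sum_(nth 0 gamma j <= r < nth 0 beta j) (i < T r j).

Definition col_count e j : nat :=
  \sum_(nth 0 gamma j <= r < nth 0 beta j) (T r j == e).

(** By (ST-2) the entries greater than [i] form the top of the skew part of the column, so their
    number tells where they end. *)
Lemma layer_colP i r j :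
  (r < layer_col i j) = in_diagram gamma r j || in_skew beta gamma r j && (i < T r j).
Proof.
rewrite ltn_initial_count ?(st_sub T_st) // => q q' le_q /andP[lt_q lt_q'] /leq_trans -> //.
apply/ltnW/(st_col T_st) => //; rewrite /in_skew.
  by rewrite le_q (ltn_trans lt_q).
by rewrite lt_q' ltnW // (leq_ltn_trans le_q).
Qed.

Lemma layer_col_anti i j k : j <= k -> layer_col i k <= layer_col i j.
Proof.
move=> le_jk; rewrite leqNgt; apply/negP => lt_jk.
(* [r] is the first row missing in column j; a box of column k there would force one in column j,
   since [beta] and [gamma] are partitions and by (ST-1). *)
have := lt_jk; rewrite layer_colP; set r := layer_col i j.
have : ~~ (r < layer_col i j) by rewrite ltnn.
rewrite layer_colP negb_or negb_and => /andP[nr_gamma].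
have gamma_jk := nth_partition_anti gamma_part le_jk.
have beta_jk := nth_partition_anti beta_part le_jk.
move=> nr_T /orP[r_gamma|/andP[skew_k lt_i]].
  by case/negP: nr_gamma; apply: leq_trans gamma_jk.
have skew_j : in_skew beta gamma r j.
  rewrite /in_skew leqNgt; apply/andP; split=> //.
  by case/andP: skew_k => _ /leq_trans; apply.
move: nr_T; rewrite skew_j /= => /negP; apply.
move: le_jk; rewrite leq_eqVlt => /predU1P[->//|lt_jk'].
exact: leq_trans lt_i (st_row T_st skew_j skew_k lt_jk').
Qed.

Lemma layer_colS i j : layer_col i j = layer_col i.+1 j + col_count i.+1 j.
Proof.
rewrite /layer_col -addnA -big_split; congr (_ + _); apply: eq_bigr => r _ /=.
by rewrite [i < _]leq_eqVlt eq_sym; case: eqP => [->|_]; rewrite ?ltnn ?addn0.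
Qed.

Lemma col_count_le1 e j : col_count e j <= 1.
Proof.
have -> : col_count e j = size
    [seq r <- index_iota (nth 0 gamma j) (nth 0 beta j) | T r j == e].
  rewrite size_filter -sum1_count big_mkcond /=; apply: eq_bigr => r _.
  by case: (T r j == e).
set t := filter _ _; have t_uniq : uniq t by rewrite filter_uniq ?iota_uniq.
have t_eq : {in t &, forall r r', r < r' -> False}.
  move=> r r'; rewrite !mem_filter !mem_index_iota => /andP[/eqP Tr skew_r].
  move=> /andP[/eqP Tr' skew_r'] /(st_col T_st skew_r skew_r').
  by rewrite Tr Tr' ltnn.
case: t t_uniq t_eq => [|r [|r' t]] //= /andP[]; rewrite inE negb_or neq_ltn.
have r_t : r \in [:: r, r' & t] by rewrite inE eqxx.
have r'_t : r' \in [:: r, r' & t] by rewrite !inE eqxx orbT.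
by move=> /andP[/orP[lt_r|lt_r] _] _ t_eq; [case: (t_eq r r')|case: (t_eq r' r)].
Qed.

(* Index shift: the entries of the strip e are e+1. *)
Definition in_strip e j : bool := 0 < col_count e.+1 j.

Lemma in_strip_nat e j : col_count e.+1 j = in_strip e j.
Proof. by rewrite /in_strip; case: col_count (col_count_le1 e.+1 j) => [|[]]. Qed.

Lemma count_strip m e :
  count_left beta gamma T m e.+1 = count (in_strip e) (iota 0 m).
Proof.
rewrite /count_left -(big_mkord xpredT (fun j => col_count e.+1 j)) -sum1_count.
rewrite [RHS]big_mkcond /index_iota subn0; apply: eq_bigr => j _.
by rewrite in_strip_nat; case: in_strip.
Qed.

Lemma col_ge_size j : size beta <= j -> nth 0 gamma j = 0 /\ nth 0 beta j = 0.
Proof.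
move=> le_j; have := st_sub T_st j; rewrite [nth 0 beta j]nth_default //.
by rewrite leqn0 => /eqP.
Qed.

(** By the content condition, a value above the largest part of [alpha] occurs zero times. *)
Lemma entry_le r j : in_skew beta gamma r j -> T r j <= nth 0 alpha 0.
Proof.
move=> skew_r; rewrite leqNgt; apply/negP => lt_T.
have lt_j : j < size beta.
  rewrite ltnNge; apply/negP => /col_ge_size[_ beta0].
  by move: skew_r; rewrite /in_skew beta0 ltn0 andbF.
have : count_left beta gamma T (size beta) (T r j) = 0.
  rewrite (st_content T_st) ?(st_pos T_st) //.
  apply/eqP; rewrite -leqn0 leqNgt -has_count; apply/hasPn => a /(nthP 0)[k lt_k <-].
  by rewrite -ltnNge (leq_ltn_trans (nth_partition_anti alpha_part (leq0n k))).
rewrite /count_left => /eqP; rewrite sum_nat_eq0 => /forallP/(_ (Ordinal lt_j)).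
rewrite /= sum_nat_seq_eq0 => /allP/(_ r).
by rewrite mem_index_iota eqxx => /(_ skew_r).
Qed.

Lemma layer_col_top j : layer_col (nth 0 alpha 0) j = nth 0 gamma j.
Proof.
rewrite /layer_col big_nat big1 ?addn0 // => r /entry_le.
by rewrite ltnNge => ->.
Qed.

Lemma layer_col0 j : layer_col 0 j = nth 0 beta j.
Proof.
rewrite /layer_col big_nat (eq_bigr (fun=> 1)) => [|r /(st_pos T_st) -> //].
by rewrite -big_nat sum_nat_const_nat muln1 subnKC ?(st_sub T_st).
Qed.

Lemma in_strip_top j : in_strip (nth 0 alpha 0) j = false.
Proof.
apply/negbTE; rewrite /in_strip -leqNgt /col_count big_nat big1 // => r /entry_le.
by case: eqP => // ->; rewrite ltnn.
Qed.

(** Cut at the first empty column to avoid zero parts; heights decrease, so all later columns are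
    empty too. *)
Definition layer i : seq nat :=
  mkseq (layer_col i) (find (fun j => layer_col i j == 0) (iota 0 (size beta))).

Lemma nth_layer i j : nth 0 (layer i) j = layer_col i j.
Proof.
rewrite /layer; set m := find _ _.
have [lt_jm|le_mj] := ltnP j m; first by rewrite nth_mkseq.
rewrite nth_default ?size_mkseq //; apply/esym/eqP; rewrite -leqn0.
have [le_j|lt_j] := leqP (size beta) j.
  by rewrite /layer_col; have [-> ->] := col_ge_size le_j; rewrite big_geq.
apply: leq_trans (layer_col_anti i le_mj) _; rewrite leqn0.
have lt_m : m < size beta by apply: leq_ltn_trans lt_j.
have /(nth_find 0) : has (fun j => layer_col i j == 0) (iota 0 (size beta)).
  by rewrite has_find size_iota.
by rewrite -/m nth_iota.
Qed.

Lemma size_layer i : size (layer i) <= size beta.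
Proof. by rewrite size_mkseq -[X in _ <= X](size_iota 0) find_size. Qed.

Lemma layer_partition i : is_partition (layer i).
Proof.
split.
  rewrite sorted_map; apply: sub_sorted (iota_ltn_sorted _ _) => j k lt_jk.
  exact/layer_col_anti/ltnW.
apply/negP => /(nthP 0)[j]; rewrite nth_layer size_mkseq => lt_j lj0.
have := before_find 0 lt_j; rewrite nth_iota ?add0n ?lj0 //.
by rewrite -[X in _ < X](size_iota 0) (leq_trans lt_j) ?find_size.
Qed.

Lemma layer_is_layer i : is_layer beta gamma T i (layer i).
Proof.
split=> [|r j]; first exact: layer_partition.
by rewrite -layer_colP /in_diagram nth_layer.
Qed.

Lemma card_strip e :
  transpose_part alpha e.+1 = #|[set j : 'I_(size beta) | in_strip e j]|.
Proof.
rewrite -(st_content T_st) // count_strip -val_enum_ord count_map -sum1_count.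
rewrite big_enum_cond -sum1_card; apply: eq_bigl => j.
by rewrite !inE.
Qed.

End SocleTableau.

(** * From the tableau to the embedding *)

(** If the zero ideal were maximal, every nonzero x would generate the unit ideal and R would be a
    field. *)
Lemma dvr_generator_neq0 (R : idomainType) (p : R) : is_dvr R ->
  is_maximal_ideal (principal p : submodClosed R^o) -> p != 0.
Proof.
case=> _ _ not_field [_ p_max]; apply/eqP => p0; case: not_field => x x0.
have x_in : x \in (principal x : submodClosed R^o).
  by apply/asboolP; exists 1; rewrite mul1r.
have [|xp|xT] := p_max (principal x : submodClosed R^o).
- move=> y /asboolP[z ->]; rewrite p0 mulr0; exact: rpred0.
- move: x_in; rewrite xp => /asboolP[y xE].
  by rewrite xE p0 mulr0 eqxx in x0.
- have /asboolP[y xy] : 1 \in (principal x : submodClosed R^o) by rewrite xT.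
  by apply/unitrP; exists y; rewrite -xy mulrC -xy.
Qed.

(** A column holds each entry at most once, so (ST-3) is the counting hypothesis of the matching. *)
Lemma socle_tableau_shift (alpha beta gamma : seq nat) (T : nat -> nat -> nat)
    (i : nat) : is_socle_tableau alpha beta gamma T ->
  exists psi : 'I_(size beta) -> 'I_(size beta),
    {in [pred k : 'I_(size beta) | in_strip beta gamma T i.+1 k] &, injective psi} /\
    forall k : 'I_(size beta), in_strip beta gamma T i.+1 k ->
      [/\ (psi k <= k)%N, in_strip beta gamma T i (psi k),
          in_strip beta gamma T i k -> psi k = k &
          ~~ in_strip beta gamma T i k -> ~~ in_strip beta gamma T i.+1 (psi k)].
Proof.
move=> T_st.
have [m|psi [psi_inj psiP]] :=
    @exists_matching (in_strip beta gamma T i) (in_strip beta gamma T i.+1) (size beta).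
  by rewrite -!(count_strip T_st) (st_lattice T_st).
(* psi k is at most k, hence a valid index, and the default of [insubd] is never reached. *)
have psiE (k : 'I_(size beta)) : in_strip beta gamma T i.+1 k ->
    val (insubd k (psi k)) = psi k.
  move=> Yk; rewrite val_insubd.
  by have [/leq_ltn_trans-> ] := psiP k (ltn_ord k) Yk.
exists (fun k : 'I_(size beta) => insubd k (psi k)).
split=> [k l Yk Yl /(congr1 val)|k Yk].
  rewrite !psiE // => /psi_inj kl; apply/val_inj/kl; by rewrite inE ltn_ord.
by rewrite psiE //; have [? ? kE ?] := psiP k (ltn_ord k) Yk; split=> // /kE kk;
  apply: val_inj; rewrite psiE.
Qed.

Theorem theorem3p9 (R : idomainType) (R_dvr : is_dvr R)
  (p : R) (p_gen : is_maximal_ideal (principal p : submodClosed R^o))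
  (alpha beta gamma : seq nat)
  (alpha_part : is_partition alpha) (beta_part : is_partition beta)
  (gamma_part : is_partition gamma)
  (Sigma : nat -> nat -> nat)
  (Sigma_st : is_socle_tableau alpha beta gamma Sigma) :
  exists (B : lmodType R) (A : submodClosed B),
    socle_tableau_of p A alpha beta gamma Sigma.
Proof.
have p_neq0 := dvr_generator_neq0 R_dvr p_gen.
have /choice[psi psiP] := fun i => socle_tableau_shift i Sigma_st.
pose n := size beta; pose s := nth 0%N alpha 0.
pose X i : pred 'I_n := fun j => in_strip beta gamma Sigma i j.
pose sigma i (j : 'I_n) := layer_col beta gamma Sigma i j.
have sigmaE i j : sigma i j = (sigma i.+1 j + X i j)%N.
  by rewrite /sigma layer_colS (in_strip_nat Sigma_st).
have sigma_anti i (j k : 'I_n) : (j <= k)%N -> (sigma i k <= sigma i j)%N.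
  exact: (layer_col_anti beta_part gamma_part Sigma_st).
have psi_le i k : X i.+1 k -> (psi i k <= k)%N by move=> /((psiP i).2 k)[].
have psi_in i k : X i.+1 k -> X i (psi i k) by move=> /((psiP i).2 k)[].
have psi_id i k : X i.+1 k -> X i k -> psi i k = k by move=> /((psiP i).2 k)[].
have psi_notin i k : X i.+1 k -> ~~ X i k -> ~~ X i.+1 (psi i k).
  by move=> /((psiP i).2 k)[].
have psi_inj i : {in X i.+1 &, injective (psi i)} := (psiP i).1.
have X_s : X s =1 pred0 by move=> j; apply: (in_strip_top alpha_part Sigma_st).
have gamma_le : (size gamma <= n)%N.
  rewrite leqNgt; apply/negP => lt_n; have [gamma0 _] := col_ge_size Sigma_st (leqnn n).
  by case: gamma_part => _ /negP[]; rewrite -gamma0 mem_nth.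
have := lat_embedding p_neq0 sigmaE sigma_anti psi_le psi_in psi_id psi_notin
  psi_inj X_s alpha_part.1 alpha_part.2 (card_strip Sigma_st).
pose L i := lat p s X psi sigma i.
move=> [B [h [A [h_surj h_ker hA A_type]]]]; exists B, A.
(* If the preimage of C in F is L_i, then B/C is F/L_i. *)
have quot_type (i : nat) (C : submodClosed B) (l : seq nat) :
    (forall x, (h x \in C) = (x \in L i)) -> (size l <= n)%N ->
    (forall j : 'I_n, nth 0%N l j = sigma i j) -> has_type p (modquot C) l.
  move=> hC le_ln lE.
  apply: (has_type_lat_quot psi_in psi_notin (i := i)
    (h := (modquot_pi C \o h : {linear _ -> _}))) => // [m|x].
    have [b ->] := modquot_pi_surj m; have [x ->] := h_surj b; by exists x.
  by transitivity (h x \in C); [exact: modquot_pi_eq0 | exact: hC].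
split=> //.
- apply: (has_type_lat_quot psi_in psi_notin (i := 0%N) h_surj h_ker) => //.
  by move=> j; rewrite /sigma (layer_col0 Sigma_st).
- apply: (quot_type s) => // j.
  by rewrite /sigma (layer_col_top alpha_part Sigma_st).
- move=> i le_is; exists (layer beta gamma Sigma i).
    exact: (layer_is_layer beta_part gamma_part Sigma_st).
  apply: (quot_type i) => [x|| j].
  (* The preimage of soc^i A consists of the x in L_s with p^i x in L_0, which is L_i. *)
  + by rewrite inE hA -linearZ h_ker; apply/esym/lat_socle.
  + exact: size_layer.
  + by rewrite (nth_layer beta_part gamma_part Sigma_st).
Qed.
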